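(* Let $d\ge1$, let $\alpha_j,\beta_j>0$ for $j=1,\dots,d$, let $D_\alpha$ and $D_\beta$ be the $d\times d$ diagonal matrices with diagonal entries $\alpha_j^2$ and $\beta_j^2$ respectively, and let $\Sigma=D_\beta^{1/2}D_\alpha^{-1/2}$. For $\frac{3-\sqrt5}{4}<b\le\frac14$ set $$h_b:=\sqrt{\frac{4b^2-6b+1}{b^2(2b-1)}} .$$ Then the method $\mathbf{Y}_{n+1}=\tilde\Psi_{h_b}^{(b)}(\mathbf{Y}_n)$ with $$\tilde\Psi_{h_b}^{(b)}:=\tilde\varphi^{[\mathbf{Q}]}_{b h_b}\circ\tilde\varphi^{[\mathbf{P}]}_{h_b/2}\circ\tilde\varphi^{[\mathbf{Q}]}_{(1-2b)h_b}\circ\tilde\varphi^{[\mathbf{P}]}_{h_b/2}\circ\tilde\varphi^{[\mathbf{Q}]}_{b h_b},$$ where $\tilde\varphi^{[\mathbf{P}]}_t$ and $\tilde\varphi^{[\mathbf{Q}]}_t$ are the exact time-$t$ flows of $\frac{d\mathbf{Y}}{dt}=[\Sigma^{-1}\mathbf{P},\,\mathbf{0}_d]^T$ and $\frac{d\mathbf{Y}}{dt}=[\mathbf{0}_d,\,-\Sigma\mathbf{Q}]^T$ respectively, provides a symplectic, reversible, stable approximation for the system $$\frac{d\mathbf{Q}}{dt}=D_\beta^{-1}\mathbf{P},\qquad \frac{d\mathbf{P}}{dt}=-D_\alpha^{-1}\mathbf{Q},$$ which preserves the Hamiltonian $H(\mathbf{Q},\mathbf{P})=\frac12\mathbf{Q}^TD_\alpha^{-1}\mathbf{Q}+\frac12\mathbf{P}^TD_\beta^{-1}\mathbf{P}$;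 that is, the one-step map $\tilde\Psi_{h_b}^{(b)}$ is symplectic, reversible and stable, and $H(\mathbf{Y}_{n+1})=H(\mathbf{Y}_n)$ for all $\mathbf{Y}_n\in\mathbb{R}^{2d}$.
   Context: Here $\mathbf{Y}=[\mathbf{Q},\mathbf{P}]^T\in\mathbb{R}^{2d}$ with $\mathbf{Q},\mathbf{P}\in\mathbb{R}^d$. Explicitly, $\tilde\varphi^{[\mathbf{P}]}_t(\mathbf{Q},\mathbf{P})=(\mathbf{Q}+t\Sigma^{-1}\mathbf{P},\,\mathbf{P})$ and $\tilde\varphi^{[\mathbf{Q}]}_t(\mathbf{Q},\mathbf{P})=(\mathbf{Q},\,\mathbf{P}-t\Sigma\mathbf{Q})$. Symplectic is with respect to the canonical symplectic form on $\mathbb{R}^{2d}$. A map $\Psi$ is reversible (momentum flip-reversible) if $\Psi(\mathbf{Q},\mathbf{P})=(\mathbf{Q}',\mathbf{P}')$ if and only if $\Psi(\mathbf{Q}',-\mathbf{P}')=(\mathbf{Q},-\mathbf{P})$. The method is linear and acts separately on each pair $(Q_j,P_j)$, $j=1,\dots,d$, by a $2\times2$ matrix of determinant $1$ whose two diagonal entries both equal $\mathrm{p}=1-\frac{h_b^2}{2}+\frac{h_b^4}{4}b(1-2b)$ (the same for every $j$); the eigenvalues of each such matrix solve $\lambda^2-2\mathrm{p}\lambda+1=0$. The method (its trajectories) is called stable when $\mathrm{p}^2-1<0$ (complex eigenvalues of modulus one) and unstable when $\mathrm{p}^2-1\ge0$.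
   Formalization: Stability (p^2-1<0) is asserted only for b<1/4: at b=1/4 one has h_b^2=8, p=-1 and p^2-1=0, so the method is not stable there as defined; all other claims are proved on the whole range, together with boundedness of all trajectories. *)

(* Defs.v *)
From HB Require Import structures.
From mathcomp Require Import all_boot all_order all_algebra.
From mathcomp Require Import all_classical all_reals all_analysis.
Set Implicit Arguments.
Unset Strict Implicit.
Unset Printing Implicit Defensive.
Import Order.TTheory GRing.Theory Num.Theory.
Import numFieldNormedType.Exports.
Local Open Scope classical_set_scope.
Local Open Scope ring_scope.

(* A state is a column vector Y = [Q, P]^T with Q, P : 'cV[R]_d. *)

Definition Qpart (R : realType) (d : nat) (Y : 'cV[R]_(d + d)) : 'cV[R]_d :=
  usubmx Y.

Definition Ppart (R : realType) (d : nat) (Y : 'cV[R]_(d + d)) : 'cV[R]_d :=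
  dsubmx Y.

Definition diag_sq (R : realType) (d : nat) (a : 'I_d -> R) : 'M[R]_d :=
  diag_mx (\row_j a j ^+ 2).

(* D^{1/2}, meant only for diagonal D with nonnegative entries: since
   Num.sqrt 0 = 0, the entrywise square root is again diagonal. *)
Definition diag_sqrt (R : realType) (d : nat) (D : 'M[R]_d) : 'M[R]_d :=
  map_mx (@Num.sqrt R) D.

Definition Sigma (R : realType) (d : nat) (alpha beta : 'I_d -> R) : 'M[R]_d :=
  diag_sqrt (diag_sq beta) *m invmx (diag_sqrt (diag_sq alpha)).

Definition vfieldP (R : realType) (d : nat) (S : 'M[R]_d)
    (Y : 'cV[R]_(d + d)) : 'cV[R]_(d + d) :=
  col_mx (invmx S *m Ppart Y) 0.

Definition vfieldQ (R : realType) (d : nat) (S : 'M[R]_d)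
    (Y : 'cV[R]_(d + d)) : 'cV[R]_(d + d) :=
  col_mx 0 (- (S *m Qpart Y)).

Definition is_flow (R : realType) (n : nat) (F : 'cV[R]_n -> 'cV[R]_n)
    (phi : R -> 'cV[R]_n -> 'cV[R]_n) : Prop :=
  forall Y, phi 0 Y = Y /\
    forall t : R, is_derive t 1 (fun s : R => phi s Y) (F (phi t Y)).

Definition exact_flowP (R : realType) (d : nat) (S : 'M[R]_d) (t : R)
    (Y : 'cV[R]_(d + d)) : 'cV[R]_(d + d) :=
  col_mx (Qpart Y + t *: (invmx S *m Ppart Y)) (Ppart Y).

Definition exact_flowQ (R : realType) (d : nat) (S : 'M[R]_d) (t : R)
    (Y : 'cV[R]_(d + d)) : 'cV[R]_(d + d) :=
  col_mx (Qpart Y) (Ppart Y - t *: (S *m Qpart Y)).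

Lemma is_derive_affine (R : realType) (n : nat) (u v : 'cV[R]_n) (t : R) :
  is_derive t 1 (fun s : R => u + s *: v) v.
Proof.
have h : (fun h : R => h^-1 *: ((u + (h *: (1 : R) + t) *: v) - (u + t *: v)))
    @ (0 : R)^' --> v.
  apply: cvg_near_cst.
  near=> x.
  have x0 : x != 0 by near: x; exact: nbhs_dnbhs_neq.
  rewrite opprD addrACA subrr add0r -scalerBl addrK scalerA.
  by rewrite -[x *: 1]/(x * 1) mulr1 mulVf// scale1r.
apply: DeriveDef; first by apply/cvg_ex; exists v; exact: h.
exact: cvg_lim h.
Unshelve. all: by end_near. Qed.

Lemma exact_flowP_is_flow (R : realType) (d : nat) (S : 'M[R]_d) :
  is_flow (vfieldP S) (exact_flowP S).
Proof.
move=> Y; split; first by rewrite /exact_flowP scale0r addr0 vsubmxK.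
move=> t.
have -> : (fun s : R => exact_flowP S s Y) = (fun s : R => Y + s *: vfieldP S Y).
  apply/funext => s; transitivity (col_mx (Qpart Y) (Ppart Y) + s *: vfieldP S Y).
    by rewrite /vfieldP scale_col_mx add_col_mx scaler0 addr0.
  by rewrite vsubmxK.
have -> : vfieldP S (exact_flowP S t Y) = vfieldP S Y.
  by rewrite /vfieldP /exact_flowP /Ppart !col_mxKd.
exact: is_derive_affine.
Qed.

Lemma exact_flowQ_is_flow (R : realType) (d : nat) (S : 'M[R]_d) :
  is_flow (vfieldQ S) (exact_flowQ S).
Proof.
move=> Y; split; first by rewrite /exact_flowQ scale0r subr0 vsubmxK.
move=> t.
have -> : (fun s : R => exact_flowQ S s Y) = (fun s : R => Y + s *: vfieldQ S Y).
  apply/funext => s; transitivity (col_mx (Qpart Y) (Ppart Y) + s *: vfieldQ S Y).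
    by rewrite /vfieldQ scale_col_mx add_col_mx scaler0 addr0 scalerN.
  by rewrite vsubmxK.
have -> : vfieldQ S (exact_flowQ S t Y) = vfieldQ S Y.
  by rewrite /vfieldQ /exact_flowQ /Qpart !col_mxKu.
exact: is_derive_affine.
Qed.

Definition h_of (R : realType) (b : R) : R :=
  Num.sqrt ((4 * b ^+ 2 - 6 * b + 1) / (b ^+ 2 * (2 * b - 1))).

Definition one_step (R : realType) (n : nat)
    (phiP phiQ : R -> 'cV[R]_n -> 'cV[R]_n) (b h : R) : 'cV[R]_n -> 'cV[R]_n :=
  phiQ (b * h) \o phiP (h / 2) \o phiQ ((1 - 2 * b) * h) \o phiP (h / 2)
    \o phiQ (b * h).

Definition canonical_form (R : realType) (d : nat) (u v : 'cV[R]_(d + d)) : R :=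
  (u^T *m block_mx 0 1%:M (- 1%:M) 0 *m v) 0 0.

Definition symplectic (R : realType) (d : nat)
    (Psi : 'cV[R]_(d + d) -> 'cV[R]_(d + d)) : Prop :=
  forall Y, differentiable Psi Y /\
    forall u v,
      canonical_form ('d Psi Y u) ('d Psi Y v) = canonical_form u v.

Definition reversible (R : realType) (d : nat)
    (Psi : 'cV[R]_(d + d) -> 'cV[R]_(d + d)) : Prop :=
  forall Q P Q' P' : 'cV[R]_d,
    Psi (col_mx Q P) = col_mx Q' P' <-> Psi (col_mx Q' (- P')) = col_mx Q (- P).

Definition QPpair (R : realType) (d : nat) (Y : 'cV[R]_(d + d)) (j : 'I_d) :
    'cV[R]_2 :=
  \col_(i < 2) (if i == 0 then Qpart Y j 0 else Ppart Y j 0).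

Definition acts_on_pairs (R : realType) (d : nat)
    (Psi : 'cV[R]_(d + d) -> 'cV[R]_(d + d)) (p : R) : Prop :=
  forall j : 'I_d, exists M : 'M[R]_2,
    [/\ forall Y, QPpair (Psi Y) j = M *m QPpair Y j,
        \det M = 1, M 0 0 = p & M 1 1 = p].

(* The eigenvalues of each 2 x 2 block solve X^2 - 2 p X + 1 = 0, so
   p^2 - 1 < 0 says that they are non-real, of modulus one. *)
Definition stable (R : realType) (d : nat)
    (Psi : 'cV[R]_(d + d) -> 'cV[R]_(d + d)) (p : R) : Prop :=
  acts_on_pairs Psi p /\ p ^+ 2 - 1 < 0.

Definition stability_coef (R : realType) (b h : R) : R :=
  1 - h ^+ 2 / 2 + h ^+ 4 / 4 * b * (1 - 2 * b).

(* For h = h_of b, the inequality in `stable` holds for b < 1/4 but fails at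
   b = 1/4: there h ^+ 2 = 8, p = -1 and the one-step map is - id, which is
   symplectic, reversible and preserves the Hamiltonian, with eigenvalues of
   modulus one and bounded trajectories, but has p ^+ 2 - 1 = 0. *)
Definition bounded_trajectories (R : realType) (n : nat)
    (Psi : 'cV[R]_n -> 'cV[R]_n) : Prop :=
  forall Y0, exists C : R, forall k : nat, `|iter k Psi Y0| <= C.

Definition Hamiltonian (R : realType) (d : nat) (alpha beta : 'I_d -> R)
    (Y : 'cV[R]_(d + d)) : R :=
  2^-1 * ((Qpart Y)^T *m invmx (diag_sq alpha) *m Qpart Y) 0 0
  + 2^-1 * ((Ppart Y)^T *m invmx (diag_sq beta) *m Ppart Y) 0 0.

(* Main.v *)
Require Import Defs.
From mathcomp Require Import all_boot all_order all_algebra.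
From mathcomp Require Import all_classical all_reals all_analysis.
From mathcomp Require Import ring lra.
Set Implicit Arguments.
Unset Strict Implicit.
Unset Printing Implicit Defensive.
Import Order.TTheory GRing.Theory Num.Theory.
Import numFieldNormedType.Exports.
Local Open Scope ring_scope.

(* The velocity of each split flow is constant along the flow, so the flows are
   affine in time and the one-step map acts on every pair (Q_j, P_j), after
   rescaling Q_j, by one and the same unimodular 2 x 2 matrix with diagonal
   entries p. The choice of h_b makes the off-diagonal entries opposite, q and
   -q, hence p^2 + q^2 = 1 and the matrix is a rotation. In the rescaled
   coordinates H is a weighted sum of the squared norms of the pairs, which
   rotations preserve; the trajectories are bounded because the powers of a
   rotation are rotations; and q <> 0 exactly when b <> 1/4. *)

(** * Calculus of linear maps and of flows with nilpotent generator *)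

Lemma mulmx_differentiable (R : realType) (m n : nat) (A : 'M[R]_(m, n))
    (Y : 'cV[R]_n) : differentiable (fun Z : 'cV[R]_n => A *m Z) Y.
Proof.
have -> : (fun Z : 'cV[R]_n => A *m Z)
    = \sum_(j < n) (fun Z : 'cV[R]_n => Z j 0 *: col j A).
  apply/funext => Z; apply/colP => i.
  rewrite fct_sumE summxE mxE; apply: eq_bigr => j _.
  by rewrite !mxE mulrC.
apply: differentiable_sum => j.
exact/differentiableZl/differentiable_coord.
Qed.

Lemma mulmx_continuous (R : realType) (m n : nat) (A : 'M[R]_(m, n)) :
  continuous (fun Z : 'cV[R]_n => A *m Z).
Proof. by move=> Y; apply/differentiable_continuous/mulmx_differentiable. Qed.

Lemma diff_mulmx (R : realType) (m n : nat) (A : 'M[R]_(m, n))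
    (Y Z : 'cV[R]_n) : 'd (fun Z : 'cV[R]_n => A *m Z) Y Z = A *m Z.
Proof. by rewrite (@diff_lin _ _ _ (mulmx A))//; exact: mulmx_continuous. Qed.

Lemma is_derive_mulmx (R : realType) (m n : nat) (A : 'M[R]_(m, n))
    (y : R -> 'cV[R]_n) (t : R) (v : 'cV[R]_n) :
  is_derive t 1 y v -> is_derive t 1 (fun s => A *m y s) (A *m v).
Proof.
case=> dy <-.
have h : ((fun h : R => h^-1 *: (A *m y (h *: (1 : R) + t) - A *m y t))
    @ (0 : R)^' --> A *m 'D_1 y t)%classic.
  under eq_fun do rewrite -mulmxBr scalemxAr.
  exact: (continuous_cvg _ (@mulmx_continuous _ _ _ A _) dy).
apply: DeriveDef; first by apply/cvg_ex; exists (A *m 'D_1 y t); exact: h.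
exact: cvg_lim h.
Qed.

(** Subtracting the affine map [t *: v] leaves a curve of zero derivative, each entry of which is a
    constant scalar function. *)
Lemma is_derive_cst_affine (R : realType) (n : nat) (y : R -> 'cV[R]_n)
    (v : 'cV[R]_n) :
  (forall t : R, is_derive t 1 y v) -> forall t, y t = y 0 + t *: v.
Proof.
move=> dy t; apply/colP => i.
pose z := y - (fun s => 0 + s *: v).
have dz (s : R) : is_derive s 1 z 0.
  by rewrite -(subrr v); apply: is_deriveB; exact: is_derive_affine.
have dzi (s : R) : is_derive s (1 : R) (fun s => z s i 0) (0 : R).
  have [dzs Dzs] := dz s.
  apply: DeriveDef; first exact: (derivable_mxP _ _ _).1.
  by have := congr1 (fun M : 'cV[R]_n => M i 0) Dzs; rewrite derive_mx// !mxE.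
have := is_derive_0_is_cst t 0 dzi.
rewrite /z !fctE !mxE !add0r mul0r subr0 => <-.
by rewrite subrK.
Qed.

(* Since [N *m N = 0], the velocity [N *m phi t Y] has zero derivative. *)
Lemma nilpotent_flow (R : realType) (n : nat) (N : 'M[R]_n)
    (phi : R -> 'cV[R]_n -> 'cV[R]_n) :
  N *m N = 0 -> is_flow (mulmx N) phi ->
  forall t Y, phi t Y = (1%:M + t *: N) *m Y.
Proof.
move=> N2 hphi t Y; have [phi0 dphi] := hphi Y.
have velocity_cst s : N *m phi s Y = N *m Y.
  have dv (u : R) : is_derive u 1 (fun s => N *m phi s Y) 0.
    by have := is_derive_mulmx N (dphi u); rewrite mulmxA N2 mul0mx.
  by have /= := is_derive_cst_affine dv s; rewrite phi0 scaler0 addr0.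
have dphi' (u : R) : is_derive u 1 (fun s => phi s Y) (N *m Y).
  by rewrite -(velocity_cst u).
have /= -> := is_derive_cst_affine dphi' t.
by rewrite phi0 mulmxDl mul1mx -scalemxAl.
Qed.

(** * Operators acting on the pairs (Q_j, P_j) *)

(* Embeds the 2 x 2 matrices into the operators on [Q, P]: the matrix [M] acts
   on each pair (Q_j, P_j) after rescaling Q_j by the j-th eigenvalue of [S]. *)
Definition pair_mx (R : comUnitRingType) (d : nat) (S : 'M[R]_d) (M : 'M[R]_2) :
    'M[R]_(d + d) :=
  block_mx (M 0 0)%:M (M 0 1 *: invmx S) (M 1 0 *: S) (M 1 1)%:M.

Definition mx22 (R : Type) (a b c e : R) : 'M[R]_2 :=
  \matrix_(i, j) if i == 0 then if j == 0 then a else b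
                 else if j == 0 then c else e.

Lemma mul_mx22 (R : pzSemiRingType) (a b c e a' b' c' e' : R) :
  mx22 a b c e *m mx22 a' b' c' e'
  = mx22 (a * a' + b * c') (a * b' + b * e') (c * a' + e * c') (c * b' + e * e').
Proof.
by apply/matrixP => -[[|[|//]] ?] [[|[|//]] ?];
  rewrite !mxE !big_ord_recl big_ord0 !mxE /= addr0.
Qed.

Lemma pair_mx22 (R : comUnitRingType) (d : nat) (S : 'M[R]_d) (a b c e : R) :
  pair_mx S (mx22 a b c e) = block_mx a%:M (b *: invmx S) (c *: S) e%:M.
Proof. by rewrite /pair_mx !mxE. Qed.

(** [S] and its inverse cancel in the products of off-diagonal blocks; compositions of flows thus
    reduce to 2 x 2 products. *)
Lemma pair_mxM (R : comUnitRingType) (d : nat) (S : 'M[R]_d) (M N : 'M[R]_2) :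
  S \in unitmx -> pair_mx S M *m pair_mx S N = pair_mx S (M *m N).
Proof.
move=> uS; rewrite /pair_mx mulmx_block -!scalar_mxM !mul_scalar_mx !mul_mx_scalar.
rewrite -!scalemxAl -!scalemxAr mulVmx// mulmxV// !scalerA !scalemx1.
rewrite !mxE !big_ord_recl !big_ord0 !addr0.
have -> : lift ord0 ord0 = 1 :> 'I_2 by apply/val_inj.
by rewrite -!raddfD /= -!scalerDl; congr block_mx; congr (_ *: _); ring.
Qed.

Lemma unitmx_diag_mx (R : fieldType) (d : nat) (s : 'rV[R]_d) :
  (forall j, s 0 j != 0) -> diag_mx s \in unitmx.
Proof.
by move=> s0; rewrite unitmxE det_diag unitfE; apply/prodf_neq0 => j _.
Qed.

Lemma invmx_diag_mx (R : fieldType) (d : nat) (s : 'rV[R]_d) :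
  (forall j, s 0 j != 0) -> invmx (diag_mx s) = diag_mx (\row_j (s 0 j)^-1).
Proof.
move=> s0; rewrite -[RHS](mulKmx (unitmx_diag_mx s0)) mulmx_diag.
rewrite (_ : diag_mx _ = 1%:M) ?mulmx1// -diag_const_mx; congr diag_mx.
by apply/rowP => j; rewrite !mxE divff.
Qed.

(** * Symplecticity, reversibility and action on pairs *)

(** With J the matrix of the canonical form and A the operator, symmetry of [S] makes A^T J A equal
    to (a e - b c) J. *)
Lemma symplectic_pair_mx22 (R : realType) (d : nat) (S : 'M[R]_d)
    (a b c e : R) :
  S \in unitmx -> S^T = S -> a * e - b * c = 1 ->
  symplectic (mulmx (pair_mx S (mx22 a b c e))).
Proof.
move=> uS trS det1 Y; split; first exact: mulmx_differentiable.
move=> u v; rewrite !diff_mulmx /canonical_form.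
rewrite trmx_mul !mulmxA -[u^T *m _ *m _]mulmxA -[u^T *m _ *m _]mulmxA.
congr ((_ *m _ *m _) 0 0).
rewrite pair_mx22 tr_block_mx !tr_scalar_mx !linearZ /= trS trmx_inv trS.
rewrite !mulmx_block !mulmx0 !mulmxN !mulmx1 !add0r !addr0.
rewrite !mulNmx !mul_mx_scalar !mul_scalar_mx -!scalemxAl -!scalemxAr.
rewrite mulVmx// mulmxV// !scalerA !scale_scalar_mx !mulr1 !addNr.
by rewrite -!raddfN -!raddfD /= -det1; congr block_mx; congr _%:M; ring.
Qed.

(** For a unimodular 2 x 2 matrix with equal diagonal entries, changing the sign of the off-diagonal
    entries gives the inverse. Hence conjugation by the momentum flip [F] inverts [A], that is, A F
    A = F. *)
Lemma reversible_pair_mx22 (R : realType) (d : nat) (S : 'M[R]_d)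
    (p b c : R) :
  S \in unitmx -> p ^+ 2 - b * c = 1 ->
  reversible (mulmx (pair_mx S (mx22 p b c p))).
Proof.
move=> uS det1; set A := pair_mx _ _.
pose F := pair_mx S (mx22 1 0 0 (- 1)).
have FE (Q P : 'cV[R]_d) : F *m col_mx Q P = col_mx Q (- P).
  rewrite /F pair_mx22 !scale0r mul_block_col !mul_scalar_mx !mul0mx.
  by rewrite addr0 add0r scale1r scaleN1r.
have FF : F *m F = 1%:M.
  rewrite pair_mxM// mul_mx22 pair_mx22 !(mul0r, mulr0, mul1r, mulr1).
  by rewrite addr0 !add0r mulrNN mulr1 !scale0r -scalar_mx_block.
have AFA : A *m F *m A = F.
  rewrite !pair_mxM// !mul_mx22; congr (pair_mx S).
  by congr mx22; nra.
move=> Q P Q' P'; rewrite -!FE; split=> [<-|E].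
  by rewrite mulmxA mulmxA AFA.
have := congr1 (mulmx (A *m F)) E.
by rewrite /= !mulmxA AFA -[A *m F *m F]mulmxA FF mulmx1 mul1mx => <-.
Qed.

Lemma acts_on_pairs_pair_mx22 (R : realType) (d : nat) (s : 'rV[R]_d)
    (p b c : R) :
  (forall j, s 0 j != 0) -> p ^+ 2 - b * c = 1 ->
  acts_on_pairs (mulmx (pair_mx (diag_mx s) (mx22 p b c p))) p.
Proof.
move=> s0 det1 j; have sj := s0 j.
(* Undoing the rescaling of Q_j by [s 0 j] is a conjugation: it keeps the determinant and the
   diagonal. *)
exists (mx22 p (b / s 0 j) (c * s 0 j) p); split; rewrite ?mxE//.
- move=> Y; rewrite -[Y in LHS]vsubmxK pair_mx22 (invmx_diag_mx s0).
  rewrite mul_block_col !mul_scalar_mx -!scalemxAl !mul_diag_mx.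
  apply/colP => -[[|[|//]] ?];
    rewrite [LHS]mxE /= /Qpart /Ppart ?col_mxKu ?col_mxKd;
    rewrite [RHS]mxE !big_ord_recl big_ord0 !mxE /=; ring.
- rewrite (expand_det_row _ 0) !big_ord_recl big_ord0 /cofactor.
  rewrite !det_mx11 !mxE /= -[RHS]det1; by field.
Qed.

(** * Rotations: bounded powers and invariant quadratic forms *)

Lemma iter_pair_mx_rotation (R : realType) (d : nat) (S : 'M[R]_d) (p q : R) :
  S \in unitmx -> p ^+ 2 + q ^+ 2 = 1 ->
  forall k, exists p' q', p' ^+ 2 + q' ^+ 2 = 1 /\
    forall Y : 'cV[R]_(d + d), iter k (mulmx (pair_mx S (mx22 p q (- q) p))) Y
      = pair_mx S (mx22 p' q' (- q') p') *m Y.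
Proof.
move=> uS pq1; elim=> [|k [p' [q' [pq1' IH]]]].
  exists 1, 0; rewrite expr1n expr0n addr0; split=> // Y.
  by rewrite [RHS]/= oppr0 (pair_mx22 S 1) !scale0r -scalar_mx_block mul1mx.
(* Real and imaginary parts of (p + i q)(p' + i q'); the modulus is multiplicative. *)
exists (p * p' - q * q'), (p * q' + q * p'); split.
  transitivity ((p ^+ 2 + q ^+ 2) * (p' ^+ 2 + q' ^+ 2)); first by ring.
  by rewrite pq1 pq1' mulr1.
move=> Y; rewrite iterS IH mulmxA pair_mxM// mul_mx22.
by congr (pair_mx S _ *m Y); congr mx22; ring.
Qed.

Lemma pair_mx_rotation (R : comUnitRingType) (d : nat) (S : 'M[R]_d) (p q : R) :
  pair_mx S (mx22 p q (- q) p)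
  = p *: 1%:M + q *: pair_mx S (mx22 0 1 (- 1) 0).
Proof.
rewrite !pair_mx22 [X in _ *: X + _]scalar_mx_block.
rewrite !scale_block_mx add_block_mx !scale_scalar_mx mulr1 mulr0 !scaler0.
by rewrite raddf0 !add0r !addr0 !scalerA mulr1 mulrN1.
Qed.

(** Every iterate is a combination of two fixed operators with coefficients of absolute value at
    most 1, so the bound does not depend on [k]. *)
Lemma bounded_trajectories_rotation (R : realType) (d : nat) (S : 'M[R]_d)
    (p q : R) :
  S \in unitmx -> p ^+ 2 + q ^+ 2 = 1 ->
  bounded_trajectories (mulmx (pair_mx S (mx22 p q (- q) p))).
Proof.
move=> uS pq1 Y; exists (`|Y| + `|pair_mx S (mx22 0 1 (- 1) 0) *m Y|) => k.
have [p' [q' [pq1' ->]]] := iter_pair_mx_rotation uS pq1 k.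
have [p'1 q'1] : `|p'| <= 1 /\ `|q'| <= 1.
  by split; rewrite -(expr_le1 (n := 2))// real_normK ?num_real//; nra.
rewrite pair_mx_rotation mulmxDl -!scalemxAl mul1mx.
rewrite (le_trans (ler_normD _ _))// !normrZ.
by rewrite lerD// ler_piMl.
Qed.

Lemma quad_form_block (R : realType) (d : nat) (A B : 'M[R]_d)
    (Y : 'cV[R]_(d + d)) :
  Y^T *m block_mx A 0 0 B *m Y
  = (Qpart Y)^T *m A *m Qpart Y + (Ppart Y)^T *m B *m Ppart Y.
Proof.
rewrite -[in LHS](vsubmxK Y) tr_col_mx mul_row_block mul_row_col.
by rewrite !mulmx0 addr0 add0r.
Qed.

Lemma HamiltonianE (R : realType) (d : nat) (alpha beta : 'I_d -> R)
    (Y : 'cV[R]_(d + d)) :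
  Hamiltonian alpha beta Y = 2^-1 * (Y^T *m
    block_mx (invmx (diag_sq alpha)) 0 0 (invmx (diag_sq beta)) *m Y) 0 0.
Proof. by rewrite /Hamiltonian quad_form_block [in RHS]mxE mulrDr. Qed.

(* A rotation preserves [Q^T (S B S) Q + P^T B P], the squared [B]-norm of
   [(S Q, P)]. *)
Lemma rotation_preserves_quad_form (R : realType) (d : nat) (S B : 'M[R]_d)
    (p q : R) (Y : 'cV[R]_(d + d)) :
  S \in unitmx -> S^T = S -> p ^+ 2 + q ^+ 2 = 1 ->
  let A := pair_mx S (mx22 p q (- q) p) in
  let G := block_mx (S *m B *m S) 0 0 B in
  (A *m Y)^T *m G *m (A *m Y) = Y^T *m G *m Y.
Proof.
move=> uS trS pq1 A G.
transitivity (Y^T *m (A^T *m G *m A) *m Y); first by rewrite trmx_mul !mulmxA.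
congr (_ *m _ *m _).
rewrite /A /G pair_mx22 tr_block_mx !tr_scalar_mx !linearZ /= trS trmx_inv trS.
rewrite !mulmx_block !mulmx0 !add0r !addr0.
rewrite !mul_mx_scalar !mul_scalar_mx -!scalemxAl -!scalemxAr !mulmxA.
rewrite (mulVmx uS) mul1mx -[B *m S *m _]mulmxA -[S *m B *m S *m _]mulmxA.
rewrite (mulmxV uS) !mulmx1 !scalerA.
rewrite !mulrN mulNr opprK !scaleNr !subrr -!scalerDl -!expr2.
by rewrite [q ^+ 2 + _]addrC pq1 !scale1r.
Qed.

(** * The scaling matrix and the weights of the Hamiltonian *)

Lemma Sigma_diag (R : realType) (d : nat) (alpha beta : 'I_d -> R) :
  (forall j, 0 < alpha j) -> (forall j, 0 < beta j) ->
  Sigma alpha beta = diag_mx (\row_j (beta j / alpha j)).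
Proof.
have sqrtE (a : 'I_d -> R) : (forall j, 0 < a j) ->
    diag_sqrt (diag_sq a) = diag_mx (\row_j a j).
  move=> a0; apply/matrixP => i j; rewrite !mxE.
  by case: eqP => _; rewrite ?mulr1n ?mulr0n ?sqrtr0// sqrtr_sqr gtr0_norm.
move=> a0 b0; rewrite /Sigma !sqrtE// invmx_diag_mx; last first.
  by move=> j; rewrite mxE gt_eqF.
by rewrite mulmx_diag; congr diag_mx; apply/rowP => j; rewrite !mxE.
Qed.

(** Puts the Hamiltonian in the form S B S on Q and B on P, with B the inverse of [diag_sq beta],
    which rotations preserve. *)
Lemma invmx_diag_sq_alpha (R : realType) (d : nat) (alpha beta : 'I_d -> R) :
  (forall j, 0 < alpha j) -> (forall j, 0 < beta j) ->
  invmx (diag_sq alpha)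
  = Sigma alpha beta *m invmx (diag_sq beta) *m Sigma alpha beta.
Proof.
move=> a0 b0; have nz (a : 'I_d -> R) : (forall j, 0 < a j) ->
    forall j, (\row_j a j ^+ 2) 0 j != 0.
  by move=> ha j; rewrite mxE sqrf_eq0 gt_eqF.
rewrite Sigma_diag// /diag_sq !invmx_diag_mx; [|exact: nz..].
rewrite !mulmx_diag; congr diag_mx; apply/rowP => j; rewrite !mxE.
by field; rewrite !gt_eqF ?a0 ?b0.
Qed.

(** * The split flows and the one-step matrix *)

(** The generator [N] is strictly block triangular, so its square is zero and the differential
    equation alone determines [phi]. *)
Lemma flowP_pair_mx (R : realType) (d : nat) (S : 'M[R]_d)
    (phi : R -> 'cV[R]_(d + d) -> 'cV[R]_(d + d)) :
  is_flow (vfieldP S) phi ->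
  forall t, phi t = mulmx (pair_mx S (mx22 1 t 0 1)).
Proof.
pose N : 'M[R]_(d + d) := block_mx 0 (invmx S) 0 0.
have -> : vfieldP S = mulmx N.
  apply/funext => Y; rewrite /N -[Y in RHS]vsubmxK mul_block_col.
  by rewrite !mul0mx add0r addr0.
move=> hphi t; apply/funext => Y; rewrite (nilpotent_flow _ hphi).
  rewrite pair_mx22 scalar_mx_block /N scale_block_mx add_block_mx.
  by rewrite !scaler0 !addr0 add0r scale0r.
by rewrite mulmx_block !(mul0mx, mulmx0) !addr0 block_mx0.
Qed.

Lemma flowQ_pair_mx (R : realType) (d : nat) (S : 'M[R]_d)
    (phi : R -> 'cV[R]_(d + d) -> 'cV[R]_(d + d)) :
  is_flow (vfieldQ S) phi ->
  forall t, phi t = mulmx (pair_mx S (mx22 1 0 (- t) 1)).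
Proof.
pose N : 'M[R]_(d + d) := block_mx 0 0 (- S) 0.
have -> : vfieldQ S = mulmx N.
  apply/funext => Y; rewrite /N -[Y in RHS]vsubmxK mul_block_col.
  by rewrite !mul0mx !addr0 mulNmx.
move=> hphi t; apply/funext => Y; rewrite (nilpotent_flow _ hphi).
  rewrite pair_mx22 scalar_mx_block /N scale_block_mx add_block_mx.
  by rewrite !scaler0 !addr0 add0r scale0r scalerN scaleNr.
by rewrite mulmx_block !(mul0mx, mulmx0) !addr0 block_mx0.
Qed.

(** The upper right entry of the 2 x 2 one-step matrix; it comes from the three inner flows, as the
    outer factors are unipotent lower triangular. *)
Definition off_diag_coef (R : realType) (b h : R) : R :=
  h * (1 - h ^+ 2 * (1 - 2 * b) / 4).

(* The equation on [h] makes the off-diagonal entries of the one-step matrix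
   opposite, so that this unimodular matrix is a rotation. *)
Lemma one_step_rotation (R : realType) (d : nat) (S : 'M[R]_d)
    (phiP phiQ : R -> 'cV[R]_(d + d) -> 'cV[R]_(d + d)) (b h : R) :
  S \in unitmx -> is_flow (vfieldP S) phiP -> is_flow (vfieldQ S) phiQ ->
  h ^+ 2 * (b ^+ 2 * (2 * b - 1)) = 4 * b ^+ 2 - 6 * b + 1 ->
  let p := stability_coef b h in
  let q := off_diag_coef b h in
  one_step phiP phiQ b h = mulmx (pair_mx S (mx22 p q (- q) p))
  /\ p ^+ 2 + q ^+ 2 = 1.
Proof.
move=> uS hP hQ hE p q.
(* [- q'] is the lower left entry of the five-factor product; [q' - q] is a multiple of the equation
   on [h]. *)
pose q' := (1 - b * h ^+ 2 / 2) * (h - b * (1 - 2 * b) * h ^+ 3 / 2).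
have q'E : q' = q.
  apply/eqP; rewrite -subr_eq0; apply/eqP.
  transitivity (h ^+ 3 / 4 * ((4 * b ^+ 2 - 6 * b + 1)
    - h ^+ 2 * (b ^+ 2 * (2 * b - 1)))).
    by rewrite /q' /q /off_diag_coef; field.
  by rewrite hE subrr mulr0.
split; last first.
  (* p^2 + q q' is the determinant of the product, equal to 1 identically in [b] and [h]. *)
  rewrite [q ^+ 2](_ : _ = q * q'); last by rewrite q'E.
  rewrite /p /q /q' /stability_coef /off_diag_coef.
  by field.
apply/funext => Y; rewrite /one_step /= !(flowP_pair_mx hP) !(flowQ_pair_mx hQ).
rewrite !mulmxA !pair_mxM// !mul_mx22 -{2}q'E.
congr (pair_mx S _ *m Y).
by congr mx22; rewrite /p /q /q' /stability_coef /off_diag_coef; field.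
Qed.

(** * The range of [b] and the step size *)

(** The roots of 4 b^2 - 6 b + 1 are (3 - sqrt 5)/4 and (3 + sqrt 5)/4, and [b] lies strictly
    between them. Numerator and denominator under the root are then both negative. *)
Lemma step_size_admissible (R : realType) (b : R) :
  (3 - Num.sqrt 5) / 4 < b -> b <= 1 / 4 ->
  [/\ 0 < b, 0 < h_of b
    & h_of b ^+ 2 * (b ^+ 2 * (2 * b - 1)) = 4 * b ^+ 2 - 6 * b + 1].
Proof.
move=> hl hu.
have s5 : Num.sqrt 5 ^+ 2 = 5 :> R by rewrite sqr_sqrtr.
have s5_ge0 : 0 <= Num.sqrt 5 :> R by rewrite sqrtr_ge0.
have b0 : 0 < b by nra.
have num0 : 4 * b ^+ 2 - 6 * b + 1 < 0 by nra.
have den0 : b ^+ 2 * (2 * b - 1) < 0 by rewrite pmulr_rlt0 ?exprn_gt0//; lra.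
have h20 : 0 < (4 * b ^+ 2 - 6 * b + 1) / (b ^+ 2 * (2 * b - 1)).
  by rewrite nmulr_rgt0// invr_lt0.
split=> //; first by rewrite sqrtr_gt0.
by rewrite sqr_sqrtr ?ltW// divfK// lt_eqF.
Qed.

(* [4 b^2 * off_diag_coef b h = h (1 - 4 b) (1 - 2 b)] *)
Lemma off_diag_coef_neq0 (R : realType) (b h : R) :
  0 < b -> b < 1 / 4 -> 0 < h ->
  h ^+ 2 * (b ^+ 2 * (2 * b - 1)) = 4 * b ^+ 2 - 6 * b + 1 ->
  off_diag_coef b h != 0.
Proof.
move=> b0 b4 h0 hE; rewrite mulf_neq0 ?gt_eqF//.
have -> : 1 - h ^+ 2 * (1 - 2 * b) / 4
    = (1 - 4 * b) * (1 - 2 * b) / (4 * b ^+ 2).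
  have E : h ^+ 2 * (1 - 2 * b) = - (4 * b ^+ 2 - 6 * b + 1) / b ^+ 2.
    by rewrite -hE; field; rewrite gt_eqF.
  by rewrite E; field; rewrite gt_eqF.
by rewrite divr_gt0 ?mulr_gt0 ?exprn_gt0//; lra.
Qed.

Theorem theorem4p4 (R : realType) (d : nat) (hd : (1 <= d)%N)
    (alpha beta : 'I_d -> R)
    (halpha : forall j, 0 < alpha j) (hbeta : forall j, 0 < beta j)
    (b : R) (hb_lower : (3 - Num.sqrt 5) / 4 < b) (hb_upper : b <= 1 / 4)
    (phiP phiQ : R -> 'cV[R]_(d + d) -> 'cV[R]_(d + d))
    (hphiP : is_flow (vfieldP (Sigma alpha beta)) phiP)
    (hphiQ : is_flow (vfieldQ (Sigma alpha beta)) phiQ) :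
  let h := h_of b in
  let p := stability_coef b h in
  let Psi := one_step phiP phiQ b h in
  [/\ symplectic Psi,
      reversible Psi,
      [/\ acts_on_pairs Psi p, b < 1 / 4 -> stable Psi p
        & bounded_trajectories Psi]
    & forall Y, Hamiltonian alpha beta (Psi Y) = Hamiltonian alpha beta Y].
Proof.
move=> h p Psi.
have [b0 h0 hE] := step_size_admissible hb_lower hb_upper.
have SE := Sigma_diag halpha hbeta.
have ratio_neq0 j : (\row_j (beta j / alpha j)) 0 j != 0.
  by rewrite mxE mulf_neq0 ?invr_eq0 ?gt_eqF.
have uS : Sigma alpha beta \in unitmx by rewrite SE unitmx_diag_mx.
have trS : (Sigma alpha beta)^T = Sigma alpha beta by rewrite SE tr_diag_mx.
have [PsiE pq1] := one_step_rotation uS hphiP hphiQ hE.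
rewrite -/h -/p in PsiE pq1; set q := off_diag_coef b h in PsiE pq1.
have det1 : p ^+ 2 - q * - q = 1 by rewrite mulrN opprK -expr2.
have pairsPsi : acts_on_pairs Psi p.
  by rewrite /Psi PsiE SE; exact: acts_on_pairs_pair_mx22.
split.
- by rewrite /Psi PsiE; apply: symplectic_pair_mx22; rewrite -?expr2.
- by rewrite /Psi PsiE; exact: reversible_pair_mx22.
- split=> //; last by rewrite /Psi PsiE; exact: bounded_trajectories_rotation.
  move=> b4; split=> //.
  (* Since p^2 - 1 = - q^2, strict stability amounts to q being nonzero. *)
  have : q != 0 by exact: off_diag_coef_neq0.
  rewrite -sqrf_eq0 -pq1 opprD addrA subrr sub0r oppr_lt0.
  by rewrite lt_neqAle sqr_ge0 eq_sym => ->.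
- move=> Y; rewrite !HamiltonianE (invmx_diag_sq_alpha halpha hbeta).
  by rewrite /Psi PsiE rotation_preserves_quad_form.
Qed.
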